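(* Let $\Lambda$ be a row-finite $k$-graph with no sources, $R$ a commutative ring with $1$, and $\mathcal{M}$ the cycline subalgebra of ${\rm KP}_R(\Lambda)$. If $\Phi:{\rm KP}_R(\Lambda)\to A$ is a ring homomorphism into a ring $A$, then $\Phi$ is injective if and only if the restriction $\Phi|_{\mathcal{M}}$ is injective.
   Context: A $k$-graph is a countable category $\Lambda$ (vertices $\Lambda^0$, paths, maps $r,s$) with a degree functor $d:\Lambda\to\mathbb{N}^k$ satisfying unique factorization: if $d(\lambda)=m+n$ there are unique $\mu,\nu$ with $s(\mu)=r(\nu)$, $d(\mu)=m,d(\nu)=n$, $\lambda=\mu\nu$. $v\Lambda=\{\lambda:r(\lambda)=v\}$, $v\Lambda^n$ those of degree $n$; row-finite with no sources means each $v\Lambda^n$ is finite and nonempty. ${\rm KP}_R(\Lambda)$ is the universal $R$-algebra generated by $p_v$ ($v\in\Lambda^0$), $s_\lambda,s_{\lambda^*}$ ($d(\lambda)\ne0$) with relations (KP1) $p_v$ mutually orthogonal idempotents; (KP2) $s_\lambda s_\mu=s_{\lambda\mu}$, $s_{\mu^*}s_{\lambda^*}=s_{(\lambda\mu)^*}$, $p_{r(\lambda)}s_\lambda=s_\lambda=s_\lambda p_{s(\lambda)}$, $p_{s(\lambda)}s_{\lambda^*}=s_{\lambda^*}=s_{\lambda^*}p_{r(\lambda)}$ when $r(\mu)=s(\lambda)$; (KP3) $s_{\lambda^*}s_\mu=\delta_{\lambda,\mu}p_{s(\lambda)}$ when $d(\lambda)=d(\mu)$; (KP4) $p_v=\sum_{\lambda\in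 v\Lambda^n}s_\lambda s_{\lambda^*}$ for $n\ne0$. Convention $s_v=s_{v^*}=p_v$. A pair $(\alpha,\beta)$ with $s(\alpha)=s(\beta)$ is a cycline pair if $s_{\alpha\gamma}s_{(\alpha\gamma)^*}=s_{\beta\gamma}s_{(\beta\gamma)^*}$ for all $\gamma\in s(\alpha)\Lambda$. The cycline subalgebra $\mathcal{M}$ is the $R$-subalgebra generated by $\{s_\alpha s_{\beta^*}: (\alpha,\beta)\text{ cycline}\}$. *)

(* Defs.v *)
From HB Require Import structures.
From mathcomp Require Import all_boot all_order all_algebra.
Set Implicit Arguments. Unset Strict Implicit. Unset Printing Implicit Defensive.
Import GRing.Theory.
Local Open Scope ring_scope.

Definition deg (k : nat) := {ffun 'I_k -> nat}.
Definition deg0 (k : nat) : deg k := [ffun => 0%N].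
Definition degadd (k : nat) (m n : deg k) : deg k := [ffun i => (m i + n i)%N].

(* A k-graph: a countable category (vertices kV, morphisms/paths kP, with
   identity morphism kid v, range kr, source ks, composition kcomp l m = "l m"
   defined when ks l = kr m) with a degree functor kd satisfying unique
   factorization.  Composition is total as a function but only constrained on
   composable pairs. *)
Record kgraph (k : nat) := KGraph {
  kV : countType;
  kP : countType;
  kr : kP -> kV;
  ks : kP -> kV;
  kid : kV -> kP;
  kcomp : kP -> kP -> kP;
  kd : kP -> deg k;
  kr_id : forall v, kr (kid v) = v;
  ks_id : forall v, ks (kid v) = v;
  kr_comp : forall l m, ks l = kr m -> kr (kcomp l m) = kr l;
  ks_comp : forall l m, ks l = kr m -> ks (kcomp l m) = ks m;
  kid_l : forall l, kcomp (kid (kr l)) l = l;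
  kid_r : forall l, kcomp l (kid (ks l)) = l;
  kcompA : forall l m n, ks l = kr m -> ks m = kr n ->
             kcomp (kcomp l m) n = kcomp l (kcomp m n);
  kd_id : forall v, kd (kid v) = deg0 k;
  kd_comp : forall l m, ks l = kr m -> kd (kcomp l m) = degadd (kd l) (kd m);
  kfactor : forall l (m n : deg k), kd l = degadd m n ->
      exists! mn : kP * kP,
        [/\ ks mn.1 = kr mn.2, kd mn.1 = m, kd mn.2 = n & l = kcomp mn.1 mn.2]
}.

Definition row_finite_no_sources k (L : kgraph k) : Prop :=
  forall (v : kV L) (n : deg k),
    (exists s : seq (kP L), forall l, (l \in s) = (kr l == v) && (kd l == n)) /\
    (exists l : kP L, kr l = v /\ kd l = n).

Definition nalg_axioms (R : comPzRingType) (B : lmodType R) (mul : B -> B -> B) : Prop :=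
  [/\ associative mul, left_distributive mul +%R, right_distributive mul +%R,
      (forall (a : R) x y, mul (a *: x) y = a *: mul x y) &
      (forall (a : R) x y, mul x (a *: y) = a *: mul x y)].

Definition rng_axioms (A : zmodType) (mul : A -> A -> A) : Prop :=
  [/\ associative mul, left_distributive mul +%R & right_distributive mul +%R].

Definition rng_hom (B A : zmodType) (mulB : B -> B -> B) (mulA : A -> A -> A)
  (f : B -> A) : Prop :=
  (forall x y, f (x + y) = f x + f y) /\ (forall x y, f (mulB x y) = mulA (f x) (f y)).

Definition nalg_hom (R : comPzRingType) (B C : lmodType R) (mulB : B -> B -> B)
  (mulC : C -> C -> C) (f : B -> C) : Prop :=
  [/\ forall x y, f (x + y) = f x + f y,
      forall (a : R) x, f (a *: x) = a *: f x &
      forall x y, f (mulB x y) = mulC (f x) (f y)].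

(* Kumjian-Pask Lambda-family in (C, mul): p v = p_v, sp l = s_l, sm l = s_{l^*},
   with the convention s_v = s_{v^*} = p_v for vertices (degree-0 paths kid v).
   The relations are imposed for all paths; for degree-0 paths they follow from
   the convention and (KP1), so this is the family of the paper. *)
Definition KP_family k (L : kgraph k) (R : comPzRingType) (C : lmodType R)
  (mul : C -> C -> C) (p : kV L -> C) (sp sm : kP L -> C) : Prop :=
  [/\
      (forall v, sp (kid v) = p v /\ sm (kid v) = p v),
      (forall v, mul (p v) (p v) = p v) /\
      (forall v w, v <> w -> mul (p v) (p w) = 0),
      (forall l m, ks l = kr m ->
         mul (sp l) (sp m) = sp (kcomp l m) /\ mul (sm m) (sm l) = sm (kcomp l m)) /\
      (forall l, [/\ mul (p (kr l)) (sp l) = sp l, mul (sp l) (p (ks l)) = sp l,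
                     mul (p (ks l)) (sm l) = sm l & mul (sm l) (p (kr l)) = sm l]),
      (forall l m, kd l = kd m ->
         mul (sm l) (sp m) = if l == m then p (ks l) else 0) &
      (forall (v : kV L) (n : deg k), n != deg0 k ->
         forall s : seq (kP L), uniq s ->
           (forall l, (l \in s) = (kr l == v) && (kd l == n)) ->
           p v = \sum_(l <- s) mul (sp l) (sm l))].

Definition is_KP_algebra k (L : kgraph k) (R : comPzRingType) (B : lmodType R)
  (mulB : B -> B -> B) (p : kV L -> B) (sp sm : kP L -> B) : Prop :=
  [/\ nalg_axioms mulB, KP_family mulB p sp sm &
      forall (C : lmodType R) (mulC : C -> C -> C) (q : kV L -> C) (tp tm : kP L -> C),
        nalg_axioms mulC -> KP_family mulC q tp tm ->
        (exists pi : B -> C, [/\ nalg_hom mulB mulC pi,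
                                 forall v, pi (p v) = q v,
                                 forall l, pi (sp l) = tp l &
                                 forall l, pi (sm l) = tm l]) /\
        (forall pi1 pi2 : B -> C,
           nalg_hom mulB mulC pi1 -> nalg_hom mulB mulC pi2 ->
           (forall v, pi1 (p v) = q v) -> (forall l, pi1 (sp l) = tp l) ->
           (forall l, pi1 (sm l) = tm l) ->
           (forall v, pi2 (p v) = q v) -> (forall l, pi2 (sp l) = tp l) ->
           (forall l, pi2 (sm l) = tm l) ->
           forall x, pi1 x = pi2 x)].

Definition cycline_pair k (L : kgraph k) (R : comPzRingType) (B : lmodType R)
  (mulB : B -> B -> B) (sp sm : kP L -> B) (a b : kP L) : Prop :=
  ks a = ks b /\
  forall g : kP L, kr g = ks a ->
    mulB (sp (kcomp a g)) (sm (kcomp a g)) = mulB (sp (kcomp b g)) (sm (kcomp b g)).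

Inductive cycline_subalg k (L : kgraph k) (R : comPzRingType) (B : lmodType R)
  (mulB : B -> B -> B) (sp sm : kP L -> B) : B -> Prop :=
  | cs_gen a b : cycline_pair mulB sp sm a b ->
      cycline_subalg mulB sp sm (mulB (sp a) (sm b))
  | cs_zero : cycline_subalg mulB sp sm 0
  | cs_add x y : cycline_subalg mulB sp sm x -> cycline_subalg mulB sp sm y ->
      cycline_subalg mulB sp sm (x + y)
  | cs_scale (c : R) x : cycline_subalg mulB sp sm x ->
      cycline_subalg mulB sp sm (c *: x)
  | cs_mul x y : cycline_subalg mulB sp sm x -> cycline_subalg mulB sp sm y ->
      cycline_subalg mulB sp sm (mulB x y).

(* Main.v *)
(* Only the implication from injectivity on M needs work. Let z <> 0 be in the
   kernel. For a long enough path b, z s_b is a nonzero combination of distinct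
   s_a with s(a) = s(b). Fix a0 in it with nonzero coefficient c. Extending all
   paths by a common g, each pair (a0 g, a g) becomes either disjoint, so that
   s_{(a0 g)*} s_{a g} = 0, or cycline, so that this product lies in M. Hence
   s_{(a0 g)*} z s_{b g} lies in M and in the kernel, and its degree-zero part is
   c p_w. The latter is nonzero, as one sees by letting KP_R(L) act on the
   functions on (infinite paths) x Z^k. *)
Require Import Defs.
From HB Require Import structures.
From mathcomp Require Import all_boot all_order all_algebra.
From mathcomp Require Import boolp functions.
Set Implicit Arguments. Unset Strict Implicit. Unset Printing Implicit Defensive.
Import GRing.Theory.
Local Open Scope ring_scope.

(** * Universal property relative to a submodule *)

(** Closure is required of a [Prop]-valued predicate, so that both linearity of an operator and an
    arbitrary induction predicate qualify. [asbool] then yields the boolean predicate from which a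
    module type is built. *)
Record submod (R : comPzRingType) (E : lmodType R) := Submod {
  submod_prop :> E -> Prop;
  submod0 : submod_prop 0;
  submodD : forall x y, submod_prop x -> submod_prop y -> submod_prop (x + y);
  submodZ : forall (a : R) x, submod_prop x -> submod_prop (a *: x) }.

Section SubmodType.
Variables (R : comPzRingType) (E : lmodType R) (S : submod E).

Definition submod_pred : {pred E} := fun x => `[< S x >].

Lemma submod_pred_closed : submod_closed submod_pred.
Proof.
split=> [|a x y /asboolP Sx /asboolP Sy]; apply/asboolP; first exact: submod0.
by apply: submodD => //; apply: submodZ.
Qed.

HB.instance Definition _ :=
  GRing.isSubmodClosed.Build R E submod_pred submod_pred_closed.

Record submod_type := SubmodElt { submod_val : E; _ : submod_val \in submod_pred }.
HB.instance Definition _ := [isSub for submod_val].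
HB.instance Definition _ := [Choice of submod_type by <:].
HB.instance Definition _ := [SubChoice_isSubLmodule of submod_type by <:].

Lemma submod_valP (x : submod_type) : S (submod_val x).
Proof. by case: x => x Sx; apply/asboolP. Qed.

Definition submod_in (x : E) : submod_type := insubd 0 x.

Lemma submod_inK (x : E) : S x -> submod_val (submod_in x) = x.
Proof. by move=> Sx; apply: insubdK; apply/asboolP. Qed.

End SubmodType.

Section Universality.
Variables (k : nat) (L : kgraph k) (R : comPzRingType) (B : lmodType R).
Variables (mulB : B -> B -> B) (p : kV L -> B) (sp sm : kP L -> B).
Hypothesis KPB : is_KP_algebra mulB p sp sm.

(* [E] itself need not be an algebra for [m]: only its submodule [S] has to be. *)
Lemma KP_universal_sub (E : lmodType R) (S : submod E) (m : E -> E -> E)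
    (q : kV L -> E) (tp tm : kP L -> E) :
  (forall x y, S x -> S y -> S (m x y)) ->
  (forall x y z, S x -> S y -> S z -> m x (m y z) = m (m x y) z) ->
  (forall x y z, S x -> S y -> S z -> m (x + y) z = m x z + m y z) ->
  (forall x y z, S x -> S y -> S z -> m x (y + z) = m x y + m x z) ->
  (forall (a : R) x y, S x -> S y -> m (a *: x) y = a *: m x y) ->
  (forall (a : R) x y, S x -> S y -> m x (a *: y) = a *: m x y) ->
  (forall v, S (q v)) -> (forall l, S (tp l)) -> (forall l, S (tm l)) ->
  KP_family m q tp tm ->
  exists pi : B -> E,
    [/\ nalg_hom mulB m pi, forall x, S (pi x), forall v, pi (p v) = q v,
        forall l, pi (sp l) = tp l & forall l, pi (sm l) = tm l].
Proof.
move=> Sm mA mDl mDr mZl mZr Sq Stp Stm [K0 [K1a K1b] [K2a K2b] K3 K4].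
pose C := (submod_type S : lmodType R).
pose mC (x y : C) : C := submod_in S (m (submod_val x) (submod_val y)).
have valm x y : submod_val (mC x y) = m (submod_val x) (submod_val y).
  by apply: submod_inK; apply: Sm; apply: submod_valP.
have valI : injective (@submod_val _ _ S) := val_inj.
have valD (x y : C) : submod_val (x + y) = submod_val x + submod_val y.
  exact: (raddfD (\val : C -> E)).
have valZ a (x : C) : submod_val (a *: x) = a *: submod_val x.
  exact: (linearZ_LR (\val : C -> E)).
have val0 : submod_val (0 : C) = 0 by exact: (raddf0 (\val : C -> E)).
have valsum (s : seq (kP L)) (f : kP L -> C) :
    submod_val (\sum_(l <- s) f l) = \sum_(l <- s) submod_val (f l).
  exact: (raddf_sum (\val : C -> E)).
have SP := @submod_valP _ _ S.
have mCax : nalg_axioms mC.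
  split=> [x y z|x y z|x y z|a x y|a x y]; apply: valI;
    rewrite ?(valm, valD, valZ) ?(mA, mDl, mDr, mZl, mZr) //;
    by apply: SP.
have [qK tpK tmK] : [/\ forall v, submod_val (submod_in S (q v)) = q v,
   forall l, submod_val (submod_in S (tp l)) = tp l &
   forall l, submod_val (submod_in S (tm l)) = tm l].
  by split=> ?; apply: submod_inK.
have fam : KP_family mC (submod_in S \o q) (submod_in S \o tp) (submod_in S \o tm).
  split=> [v|||l l' dl|v n n0 s Us sE].
  - by rewrite /=; have [-> ->] := K0 v.
  - split=> [v|v w vw]; apply: valI; rewrite valm /= !qK ?val0; first exact: K1a.
    exact: K1b.
  - split=> [l l' /K2a[lE l'E]|l]; first by split; apply: valI; rewrite valm /= ?tpK ?tmK.
    by have [] := K2b l; split; apply: valI; rewrite valm /= ?qK ?tpK ?tmK.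
  - by apply: valI; rewrite valm /= tmK tpK K3 //; case: ifP; rewrite /= ?qK ?val0.
  - apply: valI; rewrite valsum /= qK (K4 v n n0 s Us sE).
    by apply: eq_bigr => l _; rewrite valm /= tpK tmK.
(* The universal property is applied to the submodule as an algebra of its own; composing with the
   inclusion gives the map into [E]. *)
have [_ _ /(_ C mC _ _ _ mCax fam)[[pi [[piD piZ piM] piq pip pim]] _]] := KPB.
exists (fun x => submod_val (pi x)); split=> [|x|v|l|l].
- by split=> *; rewrite ?piD ?piZ ?piM.
- exact: SP.
- by rewrite piq /= qK.
- by rewrite pip /= tpK.
- by rewrite pim /= tmK.
Qed.

(** Corestricting the generators to the subalgebra [P] gives an endomorphism of [B] with values in
    [P]. It fixes the generators, so by uniqueness it is the identity. *)
Lemma KP_ind (P : B -> Prop) :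
  P 0 -> (forall x y, P x -> P y -> P (x + y)) ->
  (forall (a : R) x, P x -> P (a *: x)) ->
  (forall x y, P x -> P y -> P (mulB x y)) ->
  (forall l, P (sp l)) -> (forall l, P (sm l)) ->
  forall x, P x.
Proof.
move=> P0 PD PZ PM Psp Psm x.
have [ax fam univ] := KPB.
have [mA mDl mDr mZl mZr] := ax.
have Pp v : P (p v) by case: fam => /(_ v)[<- _].
pose S := Submod P0 PD PZ.
have [|||||pi [hom Spi piq pip pim]] :=
  @KP_universal_sub B S mulB p sp sm PM _ _ _ _ _ Pp Psp Psm fam;
  rewrite ?(mA, mDl, mDr, mZl, mZr) //.
have [_ uni] := univ B mulB p sp sm ax fam.
suff -> : x = pi x by apply: Spi.
by apply: (uni id pi).
Qed.

End Universality.

(** * Infinite paths *)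

Section Degrees.
Variable k : nat.
Implicit Types m n j : deg k.

Lemma degaddC m n : degadd m n = degadd n m.
Proof. by apply/ffunP=> i; rewrite !ffunE addnC. Qed.

Lemma degaddA m n j : degadd m (degadd n j) = degadd (degadd m n) j.
Proof. by apply/ffunP=> i; rewrite !ffunE addnA. Qed.

Lemma degadd0 m : degadd m (deg0 k) = m.
Proof. by apply/ffunP=> i; rewrite !ffunE addn0. Qed.

Lemma deg0add m : degadd (deg0 k) m = m.
Proof. by rewrite degaddC degadd0. Qed.

Lemma degaddI m n j : degadd m n = degadd m j -> n = j.
Proof. by move/ffunP=> e; apply/ffunP=> i; have := e i; rewrite !ffunE => /addnI. Qed.

Definition degz m : {ffun 'I_k -> int} := [ffun i => (m i)%:Z].

Lemma degzD m n : degz (degadd m n) = degz m + degz n.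
Proof. by apply/ffunP=> i; rewrite !ffunE PoszD. Qed.

Lemma degz_inj : injective degz.
Proof. by move=> m n /ffunP e; apply/ffunP=> i; have := e i; rewrite !ffunE => -[]. Qed.

End Degrees.

Section Paths.
Variables (k : nat) (L : kgraph k).
Local Notation "a · b" := (kcomp a b) (at level 40, left associativity).
Implicit Types (a b c d l : kP L) (m n : deg k).

(** Equal degrees of the first factors force equal degrees of the second ones by cancellation, so
    unique factorization applies. *)
Lemma kcomp_inj a b c d : ks a = kr b -> ks c = kr d -> kd a = kd c ->
  a · b = c · d -> a = c /\ b = d.
Proof.
move=> ab cd dac e.
have dbd : kd b = kd d by apply: (@degaddI _ (kd a)); rewrite -kd_comp // e kd_comp // dac.
have [x [_ uni]] := kfactor (kd_comp ab).
have: x = (a, b) by apply: uni.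
have -> : x = (c, d) by apply: uni.
by case.
Qed.

Lemma kd0 l : kd l = deg0 k -> l = kid (kr l).
Proof.
(* Both products equal [l] and have a first factor of degree zero. *)
move=> l0; have [|||| //] := @kcomp_inj l (kid (ks l)) (kid (kr l)) l.
- by rewrite kr_id.
- by rewrite ks_id.
- by rewrite kd_id.
- by rewrite kid_l kid_r.
Qed.

Lemma kfactorP l m n : kd l = degadd m n ->
  exists a b, [/\ ks a = kr b, kd a = m, kd b = n & l = a · b].
Proof. by case/kfactor=> -[a b] [abP _]; exists a, b. Qed.

Definition is_factor l m (x : kP L * kP L) :=
  [/\ ks x.1 = kr x.2, kd x.1 = m & l = x.1 · x.2].

(* Junk value [(l, l)] when [kd l] does not dominate [m]. *)
Definition factor l m : kP L * kP L :=
  if pselect (exists x, is_factor l m x) is left h then sval (cid h) else (l, l).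

Definition kpre l m := (factor l m).1.
Definition ksuf l m := (factor l m).2.

Lemma factorE a b : ks a = kr b -> factor (a · b) (kd a) = (a, b).
Proof.
move=> ab; rewrite /factor; case: pselect => [h|[]]; last by exists (a, b).
case: (cid h) => -[c d] /= [cd dc e].
by have [-> ->] := kcomp_inj ab cd (esym dc) e.
Qed.

(** An infinite path is a degree-preserving functor on pairs m <= n; it is encoded by its initial
    segments, [x n] standing for x(0,n). *)
Definition infpath (x : deg k -> kP L) :=
  (forall n, kd (x n) = n) /\
  (forall m n, exists2 t, ks (x m) = kr t & x (degadd m n) = x m · t).

(** Serves to build infinite paths from coherent families whose members may be too long: each [u n]
    is cut at degree [n]. Coherence survives because both cuts give factorizations of the same
    [u (degadd m n)] at degree [m]. *)
Lemma infpath_pre (u : deg k -> kP L) :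
  (forall n, exists j, kd (u n) = degadd n j) ->
  (forall m n, exists2 t, ks (u m) = kr t & u (degadd m n) = u m · t) ->
  infpath (fun n => kpre (u n) n) /\
  (forall n, exists2 t, ks (kpre (u n) n) = kr t & u n = kpre (u n) n · t).
Proof.
move=> du uE.
have preP n : [/\ kd (kpre (u n) n) = n, ks (kpre (u n) n) = kr (ksuf (u n) n) &
    u n = kpre (u n) n · ksuf (u n) n].
  have [j /kfactorP[a [b [ab da _ e]]]] := du n.
  have fE : factor (u n) n = (a, b) by rewrite e -[X in factor _ X]da factorE.
  by rewrite /kpre /ksuf fE.
split=> [|n]; last by have [] := preP n; exists (ksuf (u n) n).
split=> [n|m n]; first by have [] := preP n.
have [dm sm em] := preP m; have [dmn smn emn] := preP (degadd m n).
have [t st et] := uE m n.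
have [a [b [ab da db e]]] := kfactorP dmn.
have sb : ks b = kr (ksuf (u (degadd m n)) (degadd m n)) by rewrite -smn e ks_comp.
have st' : ks (ksuf (u m) m) = kr t by rewrite -st [in RHS]em ks_comp.
have [] := @kcomp_inj a (b · ksuf (u (degadd m n)) (degadd m n))
  (kpre (u m) m) (ksuf (u m) m · t).
- by rewrite kr_comp.
- by rewrite kr_comp.
- by rewrite da dm.
- by rewrite -!kcompA // -e -emn et {1}em.
by move=> ea _; exists b; rewrite -ea.
Qed.

(** Agreement at large degrees is enough, since [x n] is the initial segment of degree [n] of
    [x (degadd n m)]. *)
Lemma infpath_ext x y m : infpath x -> infpath y ->
  (forall n, x (degadd m n) = y (degadd m n)) -> x = y.
Proof.
move=> [dx xE] [dy yE] e; apply/funext=> n.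
have [t st xt] := xE n m; have [t' st' yt] := yE n m.
have [] := @kcomp_inj (x n) t (y n) t' => //; first by rewrite dx dy.
by rewrite -xt -yt degaddC e.
Qed.

Lemma infpath_kr x m : infpath x -> kr (x m) = kr (x (deg0 k)).
Proof. by case=> _ /(_ (deg0 k) m)[t st]; rewrite deg0add => ->; rewrite kr_comp. Qed.

(** * Shift and concatenation of infinite paths *)

Definition pshift m (x : deg k -> kP L) n := ksuf (x (degadd m n)) m.
(** The path [l · x n] is too long by [kd l], hence the cut at degree [n]. *)
Definition pcat l (x : deg k -> kP L) n := kpre (l · x n) n.

Lemma pshiftE m x n : infpath x ->
  ks (x m) = kr (pshift m x n) /\ x (degadd m n) = x m · pshift m x n.
Proof.
case=> dx xE; have [t st e] := xE m n.
have fE : factor (x (degadd m n)) m = (x m, t).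
  by rewrite e -[X in factor _ X](dx m) factorE.
by rewrite /pshift /ksuf fE.
Qed.

Lemma infpath_shift m x : infpath x -> infpath (pshift m x).
Proof.
move=> ix; have [dx xE] := ix; split=> [n|n j].
  have [sn en] := pshiftE m n ix.
  by apply: (@degaddI _ m); rewrite -{1}(dx m) -kd_comp // -en dx.
have [sn en] := pshiftE m n ix; have [sj ej] := pshiftE m (degadd n j) ix.
have [t st et] := xE (degadd m n) j.
have st' : ks (pshift m x n) = kr t by rewrite -st en ks_comp.
exists t => //.
have [] := @kcomp_inj (x m) (pshift m x (degadd n j)) (x m) (pshift m x n · t) => //.
  by rewrite kr_comp.
by rewrite -ej -kcompA // -en degaddA.
Qed.

Lemma infpath_cat l x : infpath x -> ks l = kr (x (deg0 k)) ->
  infpath (pcat l x) /\ forall n, pcat l x (degadd (kd l) n) = l · x n.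
Proof.
move=> ix sl; have [dx xE] := ix.
have sln n : ks l = kr (x n) by rewrite (infpath_kr _ ix).
have [|m n|ic cE] := @infpath_pre (fun n => l · x n).
- by move=> n; exists (kd l); rewrite kd_comp // dx degaddC.
- have [t st ->] := xE m n; exists t; first by rewrite ks_comp.
  by rewrite kcompA.
split=> // n; have [t st e] := cE (degadd (kd l) n).
(* The cut path and [l · x n] are initial segments of equal degree of [l · x (degadd n (kd l))]. *)
have [t' st' e'] := xE n (kd l).
have [] := @kcomp_inj (pcat l x (degadd (kd l) n)) t (l · x n) t' => //.
- by rewrite ks_comp.
- by rewrite ic.1 kd_comp // dx.
- by rewrite -e degaddC e' kcompA.
Qed.

Lemma pcatK l x : infpath x -> ks l = kr (x (deg0 k)) ->
  pcat l x (kd l) = l /\ pshift (kd l) (pcat l x) = x.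
Proof.
move=> ix sl; have [ic cE] := infpath_cat ix sl.
have cl : pcat l x (kd l) = l.
  have := cE (deg0 k); rewrite degadd0 => ->.
  by rewrite (kd0 (ix.1 _)) -sl kid_r.
split=> //; apply/funext=> n; have [sn e] := pshiftE (kd l) n ic.
rewrite cE cl in e; rewrite cl in sn.
by have [] := kcomp_inj _ sn _ e; rewrite ?(infpath_kr n ix).
Qed.

Lemma pshiftK m x : infpath x -> pcat (x m) (pshift m x) = x.
Proof.
move=> ix; have is_ := infpath_shift m ix.
have [sm _] := pshiftE m (deg0 k) ix; have [ic cE] := infpath_cat is_ sm.
apply: (infpath_ext (m := m)) => // n; have [_ ->] := pshiftE m n ix.
by rewrite -cE ix.1.
Qed.

Lemma pcat_kr l x : infpath x -> ks l = kr (x (deg0 k)) -> kr (pcat l x (deg0 k)) = kr l.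
Proof.
move=> ix sl; have [ic _] := infpath_cat ix sl.
by rewrite -(infpath_kr (kd l) ic) (pcatK ix sl).1.
Qed.

Lemma pcat_comp a b x : infpath x -> ks a = kr b -> ks b = kr (x (deg0 k)) ->
  pcat (a · b) x = pcat a (pcat b x).
Proof.
move=> ix ab bx; have [ib bE] := infpath_cat ix bx.
have abx : ks (a · b) = kr (x (deg0 k)) by rewrite ks_comp.
have abx' : ks a = kr (pcat b x (deg0 k)) by rewrite pcat_kr.
have [iab abE] := infpath_cat ix abx; have [iab' abE'] := infpath_cat ib abx'.
apply: (infpath_ext (m := kd (a · b))) => // n.
rewrite abE kd_comp // -degaddA abE' bE kcompA //.
by rewrite (infpath_kr n ix).
Qed.

Lemma pcat_id x : infpath x -> pcat (kid (kr (x (deg0 k)))) x = x.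
Proof.
move=> ix; have [|ic cE] := infpath_cat (l := kid (kr (x (deg0 k)))) ix.
  by rewrite ks_id.
apply: (infpath_ext (m := deg0 k)) => // n.
by have := cE n; rewrite kd_id -(infpath_kr n ix) kid_l deg0add.
Qed.

Hypothesis rfns : row_finite_no_sources L.

(** As there are no sources, paths of degree (1,...,1) can be appended forever; [y t] is the result
    after [t] rounds, of degree (t,...,t). *)
Lemma infpath_exists v : exists2 x, infpath x & kr (x (deg0 k)) = v.
Proof.
have ext w : {e : kP L | kr e = w & kd e = [ffun=> 1%N]}.
  by apply: cid2; have [_ [l []]] := rfns w [ffun=> 1%N]; exists l.
pose y := fix y t := if t is t'.+1 then y t' · s2val (ext (ks (y t'))) else kid v.
have yS t : ks (y t) = kr (s2val (ext (ks (y t)))) by case: (ext _).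
have dy t : kd (y t) = [ffun=> t].
  elim: t => [|t IH] /=; first by rewrite kd_id; apply/ffunP=> i; rewrite !ffunE.
  by rewrite kd_comp // IH (s2valP' (ext _)); apply/ffunP=> i; rewrite !ffunE addn1.
have yD s t : exists2 u, ks (y s) = kr u & y (s + t)%N = y s · u.
  elim: t => [|t [u su e]].
    by exists (kid (ks (y s))); rewrite ?kr_id // addn0 kid_r.
  exists (u · s2val (ext (ks (y (s + t)%N)))).
    by rewrite kr_comp // -yS e ks_comp.
  rewrite addnS /= -kcompA //; first by rewrite -e.
  by rewrite -yS e ks_comp.
(* The sum of the entries dominates each entry, so [y (N n)] is long enough, and it is additive,
   which makes the family coherent. *)
pose N (n : deg k) := (\sum_i n i)%N.
have [|m n|ix xE] := @infpath_pre (fun n => y (N n)).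
- move=> n; exists [ffun i => N n - n i]%N; rewrite dy; apply/ffunP=> i.
  by rewrite !ffunE subnKC // /N (bigD1 i) //= leq_addr.
- have -> : N (degadd m n) = (N m + N n)%N.
    by rewrite /N -big_split; apply: eq_bigr => i _; rewrite ffunE.
  exact: yD.
exists (fun n => kpre (y (N n)) n) => //.
have [t st e] := xE (deg0 k).
have y0 : y (N (deg0 k)) = kid v by rewrite /N big1 // => i _; rewrite ffunE.
by rewrite -(kr_comp st) -e y0 kr_id.
Qed.

End Paths.

(** * The infinite path representation *)

Section Representation.
Variables (k : nat) (L : kgraph k) (R : comPzRingType).
Implicit Types (l : kP L) (v : kV L).

(* The [Z^k] coordinate makes the representation separate the homogeneous
   components of the grading by degree. *)
Definition point := ((deg k -> kP L) * {ffun 'I_k -> int})%type.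

Definition vertex_map v (a : point) : option point :=
  if pselect (infpath a.1 /\ kr (a.1 (deg0 k)) = v) then Some a else None.

Definition shift_map l (a : point) : option point :=
  if pselect (infpath a.1 /\ a.1 (kd l) = l)
  then Some (pshift (kd l) a.1, a.2 - degz (kd l)) else None.

Definition cat_map l (a : point) : option point :=
  if pselect (infpath a.1 /\ kr (a.1 (deg0 k)) = ks l)
  then Some (pcat l a.1, a.2 + degz (kd l)) else None.

Definition operator := (point -> R^o) -> (point -> R^o).

(** Pullback along a partial map, zero where the map is undefined. Pullback reverses composition, so
    s_l is represented by the shift removing [l] and s_{l*} by concatenation with [l]. *)
Definition transfer (g : point -> option point) : operator :=
  fun f a => oapp f 0 (g a).

Definition comp_op (S T : operator) : operator := S \o T.

Lemma transfer_comp g h :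
  comp_op (transfer g) (transfer h) = transfer (fun a => obind h (g a)).
Proof. by apply/funext=> f; apply/funext=> a; rewrite /comp_op /transfer /=; case: (g a). Qed.

Lemma comp_vertex v (g : point -> option point) :
  (forall a, g a -> infpath a.1 /\ kr (a.1 (deg0 k)) = v) ->
  (fun a => obind g (vertex_map v a)) = g.
Proof.
move=> gP; apply/funext=> a; rewrite /vertex_map; case: pselect => //= nv.
by case e: (g a) => //; case: nv; apply: gP; rewrite e.
Qed.

Lemma vertex_comp v (g : point -> option point) :
  (forall a b, g a = Some b -> infpath b.1 /\ kr (b.1 (deg0 k)) = v) ->
  (fun a => obind (vertex_map v) (g a)) = g.
Proof.
move=> gP; apply/funext=> a; case e: (g a) => [b|//] /=.
by rewrite /vertex_map; case: pselect => // nv; case: nv; apply: gP e.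
Qed.

Lemma shift_mapP l a b : shift_map l a = Some b ->
  [/\ infpath a.1, kr (a.1 (deg0 k)) = kr l, infpath b.1 & kr (b.1 (deg0 k)) = ks l].
Proof.
rewrite /shift_map; case: pselect => // -[ia al] [<-] /=; split=> //.
- by rewrite -(infpath_kr (kd l) ia) al.
- exact: infpath_shift.
- by have [] := pshiftE (kd l) (deg0 k) ia; rewrite al.
Qed.

Lemma cat_mapP l a b : cat_map l a = Some b ->
  [/\ infpath a.1, kr (a.1 (deg0 k)) = ks l, infpath b.1 & kr (b.1 (deg0 k)) = kr l].
Proof.
rewrite /cat_map; case: pselect => // -[ia al] [<-] /=; split=> //.
- by have [] := infpath_cat ia (esym al).
- by rewrite pcat_kr.
Qed.

Lemma shift_mapE l (x : deg k -> kP L) t : infpath x -> ks l = kr (x (deg0 k)) ->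
  shift_map l (pcat l x, t) = Some (x, t - degz (kd l)).
Proof.
move=> ix lx; have [ic _] := infpath_cat ix lx; have [cl cs] := pcatK ix lx.
by rewrite /shift_map /= cs; case: pselect => // -[].
Qed.

Lemma shift_map_cat l a b : shift_map l a = Some b ->
  a = (pcat l b.1, b.2 + degz (kd l)).
Proof.
rewrite /shift_map; case: pselect => // -[ia al] [<-] /=.
by rewrite subrK -{1}al pshiftK //; case: a {ia al}.
Qed.

Lemma cat_mapE l (x : deg k -> kP L) t : infpath x -> ks l = kr (x (deg0 k)) ->
  cat_map l (x, t) = Some (pcat l x, t + degz (kd l)).
Proof. by move=> ix lx; rewrite /cat_map; case: pselect => // -[]. Qed.

(* [shift_map l] is inverse to [cat_map l]; this turns identities between shifts
   into identities between concatenations. *)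
Lemma shift_cat_map l a b : shift_map l a = Some b <-> cat_map l b = Some a.
Proof.
split=> [e|].
  have [_ _ ib rb] := shift_mapP e; rewrite (shift_map_cat e).
  by case: b ib rb {e} => x t /= ix rx; rewrite cat_mapE.
move=> e; have [ib rb _ _] := cat_mapP e; case: b ib rb e => x t /= ix rx.
by rewrite cat_mapE // => -[<-]; rewrite shift_mapE // addrK.
Qed.

Lemma option_ext (T : Type) (u w : option T) :
  (forall b, u = Some b <-> w = Some b) -> u = w.
Proof.
case: u => [b|] e; first by have [/(_ erefl)] := e b.
by case: w e => // b e; have [_ /(_ erefl)] := e b.
Qed.

Lemma obindP (T U : Type) (g : T -> option U) u b :
  obind g u = Some b <-> exists2 c, u = Some c & g c = Some b.
Proof. by split=> [|[c -> //]]; case: u => [c|] //= gc; exists c. Qed.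

Lemma cat_map_comp l l' a : ks l = kr l' ->
  obind (cat_map l) (cat_map l' a) = cat_map (kcomp l l') a.
Proof.
move=> ll'; have sll := ks_comp ll'.
rewrite [cat_map l' _]/cat_map [in RHS]/cat_map; case: pselect => [[ia al]|na]; last first.
  by case: pselect => // -[ia al]; case: na; rewrite -sll.
rewrite /=; case: pselect => [h|na] /=; last by case: na; rewrite sll.
rewrite cat_mapE ?pcat_kr //; last by have [] := infpath_cat ia (esym al).
by rewrite pcat_comp // kd_comp // degzD -addrA (addrC (degz (kd l'))).
Qed.

Lemma shift_map_comp l l' a : ks l = kr l' ->
  obind (shift_map l') (shift_map l a) = shift_map (kcomp l l') a.
Proof.
move=> ll'; apply: option_ext => b; rewrite shift_cat_map -cat_map_comp // !obindP.
by split=> -[c /shift_cat_map ? /shift_cat_map ?]; exists c.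
Qed.

Lemma cat_map_id v : cat_map (kid v) = vertex_map v.
Proof.
apply/funext=> -[x t]; rewrite /cat_map /vertex_map ks_id.
case: pselect => // -[/= ix <-]; rewrite pcat_id // kd_id.
by congr (Some (_, _)); apply/ffunP=> i; rewrite !ffunE addr0.
Qed.

Lemma shift_map_id v : shift_map (kid v) = vertex_map v.
Proof.
apply/funext=> a; apply: option_ext => b; rewrite shift_cat_map cat_map_id.
by rewrite /vertex_map; split; case: pselect => // h [e]; subst; case: pselect.
Qed.

Lemma cat_shift_map l l' a : kd l = kd l' ->
  obind (shift_map l') (cat_map l a) = if l == l' then vertex_map (ks l) a else None.
Proof.
move=> dl; rewrite /cat_map /vertex_map; case: pselect => [[ia al]|na] /=; last by case: eqP.
case: eqP => [<-|ne] /=; first by rewrite shift_mapE // addrK; case: a {ia al}.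
rewrite /shift_map; case: pselect => //= -[_]; rewrite -dl (pcatK ia (esym al)).1.
by move=> /ne.
Qed.

Lemma shift_then_cat_map l a : obind (cat_map l) (shift_map l a) =
  if pselect (infpath a.1 /\ a.1 (kd l) = l) then Some a else None.
Proof.
case e: (shift_map l a) => [b|] /=; last by move: e; rewrite /shift_map; case: pselect.
move: (e); rewrite /shift_map; case: pselect => //= h _.
exact/shift_cat_map.
Qed.

Lemma transfer_family : KP_family (C := operator) comp_op
  (fun v => transfer (vertex_map v)) (fun l => transfer (shift_map l))
  (fun l => transfer (cat_map l)).
Proof.
split=> [v|||l l' dl|v n _ s Us sE].
- by rewrite shift_map_id cat_map_id.
- split=> [v|v w vw]; rewrite transfer_comp.
    by congr transfer; apply: vertex_comp => a b; rewrite /vertex_map; case: pselect => // h [<-].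
  apply/funext=> f; apply/funext=> a; rewrite /transfer /vertex_map.
  by case: pselect => //= h; case: pselect => //= h'; case: vw; rewrite -h.2 h'.2.
- split=> [l l' ll'|l].
    rewrite !transfer_comp; split; congr transfer; apply/funext=> a.
      exact: shift_map_comp.
    exact: cat_map_comp.
  split; rewrite transfer_comp; congr transfer.
  + by apply: comp_vertex => a; case e: (shift_map l a) => // _; have [] := shift_mapP e.
  + by apply: vertex_comp => a b /shift_mapP[].
  + by apply: comp_vertex => a; case e: (cat_map l a) => // _; have [] := cat_mapP e.
  + by apply: vertex_comp => a b /cat_mapP[].
- rewrite transfer_comp; apply/funext=> f; apply/funext=> a.
  by rewrite /transfer cat_shift_map //; case: eqP.
- apply/funext=> f; apply/funext=> a; rewrite !fct_sumE.
  under eq_bigr do rewrite transfer_comp /transfer shift_then_cat_map.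
  rewrite /transfer /vertex_map; case: pselect => [[ia av]|na] /=.
    (* Only one term of (KP4) survives at [a]: that of the initial segment [a.1 n]. *)
    have xs : a.1 n \in s by rewrite sE (infpath_kr n ia) av ia.1 !eqxx.
    rewrite (bigD1_seq (a.1 n)) //= ia.1 big_seq_cond big1 ?addr0 => [|l].
      by case: pselect => // -[].
    by rewrite sE => /andP[/andP[_ /eqP->] ne]; case: pselect => //= h; rewrite h.2 eqxx in ne.
  rewrite big_seq big1 // => l; rewrite sE => /andP[/eqP lv /eqP ln].
  case: pselect => //= h; case: na; split; first exact: h.1.
  by rewrite -(infpath_kr (kd l) h.1) h.2.
Qed.

(** Composition of arbitrary maps distributes over sums in the left factor only. Linearity of the
    left factor is what gives the distributive and scalar laws in the right factor. *)
Definition linear_op (S : operator) : Prop :=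
  (forall f g, S (f + g) = S f + S g) /\ (forall (c : R) f, S (c *: f) = c *: S f).

Lemma linear_op_transfer g : linear_op (transfer g).
Proof.
split=> [f f'|c f]; apply/funext=> a.
  rewrite -[RHS]/(transfer g f a + transfer g f' a) /transfer.
  by case: (g a); rewrite //= addr0.
rewrite -[RHS]/(c *: transfer g f a) /transfer.
by case: (g a); rewrite //= scaler0.
Qed.

Lemma linear_op0 : linear_op 0.
Proof.
split=> [f g|c f]; apply/funext=> a.
  by rewrite -[RHS]/(0 + 0 : R^o) addr0.
by rewrite -[RHS]/(c *: 0 : R^o) scaler0.
Qed.

Lemma linear_opD S T : linear_op S -> linear_op T -> linear_op (S + T).
Proof.
move=> [SD SZ] [TD TZ]; split=> [f g|c f].
  by rewrite -[LHS]/(S (f + g) + T (f + g)) SD TD addrACA.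
by rewrite -[LHS]/(S (c *: f) + T (c *: f)) SZ TZ -scalerDr.
Qed.

Lemma linear_opZ (c : R) S : linear_op S -> linear_op (c *: S).
Proof.
move=> [SD SZ]; split=> [f g|d f].
  by rewrite -[LHS]/(c *: S (f + g)) SD scalerDr.
by rewrite -[LHS]/(c *: S (d *: f)) SZ !scalerA mulrC.
Qed.

Lemma path_representation (B : lmodType R) (mulB : B -> B -> B) (p : kV L -> B)
    (sp sm : kP L -> B) : is_KP_algebra mulB p sp sm ->
  exists pi : B -> operator,
    [/\ nalg_hom mulB comp_op pi, forall v, pi (p v) = transfer (vertex_map v),
        forall l, pi (sp l) = transfer (shift_map l) &
        forall l, pi (sm l) = transfer (cat_map l)].
Proof.
move=> KPB; pose S := Submod linear_op0 linear_opD linear_opZ.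
have [|||||||||pi [hom _ piq pip pim]] := @KP_universal_sub _ _ _ _ _ _ _ _ KPB
    operator S comp_op _ _ _ _ _ _ _ _ _ _ _ _ transfer_family;
  try by [ | move=> *; exact: linear_op_transfer | exists pi].
- move=> T U [TD TZ] [UD UZ]; split=> [f g|c f]; rewrite /comp_op /=.
    by rewrite UD TD.
  by rewrite UZ TZ.
- by move=> T U W [TD _] _ _; apply/funext=> f; rewrite /comp_op /= TD.
- by move=> c T U [_ TZ] _; apply/funext=> f; rewrite /comp_op /= TZ.
Qed.

End Representation.

(** * Cycline pairs and the uniqueness theorem *)

Section KumjianPask.
Variables (k : nat) (L : kgraph k) (R : comPzRingType) (B : lmodType R).
Variables (mulB : B -> B -> B) (p : kV L -> B) (sp sm : kP L -> B).
Hypotheses (rfns : row_finite_no_sources L) (KPB : is_KP_algebra mulB p sp sm).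
Local Notation "a · b" := (kcomp a b) (at level 40, left associativity).
Local Notation "x ** y" := (mulB x y) (at level 40, left associativity).
Implicit Types (a b c d l : kP L) (m n : deg k) (x y z : B).

Let ax : nalg_axioms mulB. Proof. by case: KPB. Qed.
Let fam : KP_family mulB p sp sm. Proof. by case: KPB. Qed.

(** * Computation rules in the Kumjian-Pask algebra *)

Lemma KPA x y z : x ** (y ** z) = x ** y ** z. Proof. by have [H _ _ _ _] := ax; apply: H. Qed.
Lemma KPDl x y z : (x + y) ** z = x ** z + y ** z. Proof. by have [_ H _ _ _] := ax; apply: H. Qed.
Lemma KPDr x y z : x ** (y + z) = x ** y + x ** z. Proof. by have [_ _ H _ _] := ax; apply: H. Qed.
Lemma KPZl (r : R) x y : (r *: x) ** y = r *: (x ** y).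
Proof. by have [_ _ _ H _] := ax; apply: H. Qed.
Lemma KPZr (r : R) x y : x ** (r *: y) = r *: (x ** y).
Proof. by have [_ _ _ _ H] := ax; apply: H. Qed.
Lemma KP0l x : 0 ** x = 0. Proof. by rewrite -(scale0r (0 : B)) KPZl !scale0r. Qed.
Lemma KP0r x : x ** 0 = 0. Proof. by rewrite -(scale0r (0 : B)) KPZr !scale0r. Qed.

Lemma KP_suml (I : Type) (s : seq I) (F : I -> B) x :
  (\sum_(i <- s) F i) ** x = \sum_(i <- s) F i ** x.
Proof. exact: (big_morph (mulB^~ x) (fun y z => KPDl y z x) (KP0l x)). Qed.

Lemma KP_sumr (I : Type) (s : seq I) (F : I -> B) x :
  x ** (\sum_(i <- s) F i) = \sum_(i <- s) x ** F i.
Proof. exact: (big_morph (mulB x) (KPDr x) (KP0r x)). Qed.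

Lemma sp_kid v : sp (kid v) = p v. Proof. by case: fam => /(_ v)[]. Qed.
Lemma sm_kid v : sm (kid v) = p v. Proof. by case: fam => /(_ v)[]. Qed.
Lemma p_idem v : p v ** p v = p v. Proof. by case: fam => _ [H _]. Qed.
Lemma p_orth v w : v <> w -> p v ** p w = 0.
Proof. by case: fam => _ [_ H] _ _ _; apply: H. Qed.

Lemma sp_comp a b : ks a = kr b -> sp a ** sp b = sp (a · b).
Proof. by case: fam => _ _ [H _] _ _ /H[]. Qed.

Lemma sm_comp a b : ks a = kr b -> sm b ** sm a = sm (a · b).
Proof. by case: fam => _ _ [H _] _ _ /H[]. Qed.

Lemma p_sp a : p (kr a) ** sp a = sp a. Proof. by case: fam => _ _ [_ /(_ a)[]]. Qed.
Lemma sp_p a : sp a ** p (ks a) = sp a. Proof. by case: fam => _ _ [_ /(_ a)[]]. Qed.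
Lemma sm_p a : sm a ** p (kr a) = sm a. Proof. by case: fam => _ _ [_ /(_ a)[]]. Qed.

Lemma sm_sp a b : kd a = kd b -> sm a ** sp b = if a == b then p (ks a) else 0.
Proof. by case: fam => _ _ _ H _; apply: H. Qed.

Lemma sm_spK a : sm a ** sp a = p (ks a). Proof. by rewrite sm_sp // eqxx. Qed.

Lemma p_sum v n : exists s : seq (kP L),
  [/\ uniq s, forall l, (l \in s) = (kr l == v) && (kd l == n) &
      p v = \sum_(l <- s) sp l ** sm l].
Proof.
have [[s sE] _] := rfns v n; have sE' l : (l \in undup s) = (kr l == v) && (kd l == n).
  by rewrite mem_undup sE.
exists (undup s); split; rewrite ?undup_uniq //.
have [n0|n0] := eqVneq n (deg0 k); last first.
  by case: fam => _ _ _ _ H; apply: (H v n n0); rewrite ?undup_uniq.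
(* Degree zero is not covered by (KP4); there the sum has the single term of [kid v]. *)
have vs : kid v \in undup s by rewrite sE' kr_id kd_id n0 !eqxx.
rewrite (bigD1_seq (kid v)) ?undup_uniq //= sp_kid sm_kid p_idem big_seq_cond big1 ?addr0 // => l.
rewrite sE' => /andP[/andP[/eqP lv /eqP l0] /negP[]].
by rewrite -lv -kd0 // l0.
Qed.

(** Cut [l] at the degree of [a]: by (KP3) the products vanish unless the first piece is [a]
    itself. *)
Lemma sm_sp_cases a l n : kd l = degadd (kd a) n ->
  (exists t, [/\ ks a = kr t, l = a · t, kd t = n, sm a ** sp l = sp t & sm l ** sp a = sm t])
  \/ (sm a ** sp l = 0 /\ sm l ** sp a = 0).
Proof.
case/kfactorP=> b [t [bt db dt ->]].
have -> : sm a ** sp (b · t) = (if a == b then p (ks a) else 0) ** sp t.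
  by rewrite -sp_comp // KPA sm_sp.
have -> : sm (b · t) ** sp a = sm t ** (if b == a then p (ks b) else 0).
  by rewrite -sm_comp // -KPA sm_sp.
have [ab|ab] := eqVneq a b; last by right; rewrite KP0l KP0r.
by subst b; left; exists t; rewrite bt p_sp sm_p.
Qed.

Lemma sm_sp_ext a b g : ks a = kr g -> ks b = kr g ->
  sm (a · g) ** sp (b · g) = sm g ** (sm a ** sp b) ** sp g.
Proof. by move=> ag bg; rewrite -sp_comp // -sm_comp // !KPA. Qed.

(** * Range projections *)

Definition proj a := sp a ** sm a.

Lemma proj_expand a n : exists s : seq (kP L),
  (forall d, d \in s -> kr d = ks a /\ kd d = n) /\
  proj a = \sum_(d <- s) proj (a · d).
Proof.
have [s [_ sE ps]] := p_sum (ks a) n; exists s; split.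
  by move=> d; rewrite sE => /andP[/eqP-> /eqP->].
rewrite /proj -[sp a]sp_p ps KP_sumr KP_suml big_seq [RHS]big_seq.
apply: eq_bigr => d; rewrite sE => /andP[/eqP rd _].
by rewrite -sp_comp // -sm_comp // !KPA.
Qed.

(** Expand [proj a] into the projections of [a · d] with [d] of the degree of [b]. Each [a · d] must
    extend [b], since otherwise s_{(ad)*} s_b = 0 and hence s_{(ad)*} s_{bd} = 0; so [proj b]
    absorbs every term. *)
Lemma proj_le a b :
  (forall g, kr g = ks a -> sm (a · g) ** sp (b · g) != 0) -> ks a = ks b ->
  proj b ** proj a = proj a /\ proj a ** proj b = proj a.
Proof.
move=> nz sab; have [s [sE ->]] := proj_expand a (kd b).
suff H d : d \in s -> proj b ** proj (a · d) = proj (a · d) /\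
    proj (a · d) ** proj b = proj (a · d).
  by rewrite KP_sumr KP_suml; split; apply: eq_big_seq => d /H[].
move=> /sE[rd dd]; have bd : ks b = kr d by rewrite -sab.
have dad : kd (a · d) = degadd (kd b) (kd a) by rewrite kd_comp // dd degaddC.
have [[t [bt e dt e1 e2]]|[_ e0]] := sm_sp_cases dad; last first.
  by move: (nz d rd); rewrite -sp_comp // KPA e0 KP0l eqxx.
rewrite /proj; split.
  by rewrite KPA -[_ ** sp (a · d)]KPA e1 sp_comp // -e.
by rewrite -!KPA [sm (a · d) ** _]KPA e2 sm_comp // -e.
Qed.

(** By [proj_le] in both directions, [proj b ** proj a] equals each of the two projections. *)
Lemma proj_eq a b : ks a = ks b ->
  (forall g, kr g = ks a -> sm (a · g) ** sp (b · g) != 0 /\ sm (b · g) ** sp (a · g) != 0) ->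
  proj a = proj b.
Proof.
move=> sab nz.
have [e1 _] := @proj_le a b (fun g rg => (nz g rg).1) sab.
have [|_ e2] := @proj_le b a _ (esym sab); last by rewrite -e1 e2.
by move=> g rg; apply: (nz g _).2; rewrite rg.
Qed.

(** Insert (KP4) at degree d(b) + d(a) between s_{b*} and s_a. A term can survive only for a common
    extension l = at = bu, and then p_{s(l)} = s_{t*} (s_{a*} s_b) s_u = 0 kills it too. *)
Lemma sm_sp0_sym a b : sm a ** sp b = 0 -> sm b ** sp a = 0.
Proof.
move=> ab0; have [s [_ sE ps]] := p_sum (kr b) (degadd (kd b) (kd a)).
rewrite -[sm b]sm_p ps KP_sumr KP_suml big_seq big1 // => l.
rewrite sE => /andP[_ /eqP dl].
have [[u [bu le _ e _]]|[e _]] := sm_sp_cases dl; last by rewrite KPA e !KP0l.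
have [[t [at_ le' _ _ e']]|[_ e']] := sm_sp_cases (etrans dl (degaddC _ _)); last first.
  by rewrite -!KPA e' !KP0r.
have pl0 : p (ks l) = 0.
  rewrite -sm_spK {1}le' le -sm_comp // -sp_comp // KPA -[_ ** sm a ** _]KPA.
  by rewrite ab0 KP0r KP0l.
by rewrite KPA e -KPA e' -[sp u]sp_p -(ks_comp bu) -le pl0 KP0r KP0l.
Qed.

(** * Cycline pairs and their extensions *)

Local Notation cycline := (cycline_pair mulB sp sm).
Local Notation M := (cycline_subalg mulB sp sm).

Lemma cycline_ext a b g : cycline a b -> kr g = ks a -> cycline (a · g) (b · g).
Proof.
move=> [sab ab] rg; have bg : ks b = kr g by rewrite -sab.
split; first by rewrite !ks_comp.
move=> h; rewrite ks_comp // => rh; rewrite !kcompA //.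
by apply: ab; rewrite kr_comp.
Qed.

(** If no extension makes the product vanish, then the products for all extensions are nonzero in
    both orders, and [proj_eq] shows that the pair is already cycline. *)
Lemma cycline_or_disjoint a b : ks a = ks b ->
  exists g, kr g = ks a /\ (sm (a · g) ** sp (b · g) = 0 \/ cycline (a · g) (b · g)).
Proof.
move=> sab; case: (pselect (exists2 g, kr g = ks a & sm (a · g) ** sp (b · g) = 0)).
  by case=> g rg e; exists g; split=> //; left.
move=> nex; have nz g : kr g = ks a -> sm (a · g) ** sp (b · g) != 0.
  by move=> rg; apply/eqP=> e; case: nex; exists g.
have bk : b · kid (ks a) = b by rewrite sab kid_r.
exists (kid (ks a)); rewrite kr_id kid_r bk; split=> //; right; split=> // g rg.
have bg : ks b = kr g by rewrite -sab.
apply: proj_eq => [|h]; first by rewrite !ks_comp.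
rewrite ks_comp // => rh; rewrite !kcompA //.
have rgh : kr (g · h) = ks a by rewrite kr_comp.
split; first exact: nz.
by apply: contra_neq (nz _ rgh) => /sm_sp0_sym.
Qed.

Lemma cycline_subalg_sum (s : seq (kP L)) (F : kP L -> B) :
  (forall d, d \in s -> M (F d)) -> M (\sum_(d <- s) F d).
Proof.
move=> MF; rewrite big_seq; elim/big_ind: _ => //; [exact: cs_zero|exact: cs_add].
Qed.

(* A common extension [a t = b u] of a cycline pair makes [(t, u)] cycline. *)
Lemma cycline_sm_sp a b : cycline a b -> M (sm a ** sp b).
Proof.
move=> [sab ab]; have [s [_ sE ps]] := p_sum (kr a) (degadd (kd a) (kd b)).
rewrite -[sm a]sm_p ps KP_sumr KP_suml; apply: cycline_subalg_sum => l.
rewrite sE => /andP[_ /eqP dl].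
have [[t [at_ le _ e _]]|[e _]] := sm_sp_cases dl; last first.
  by rewrite KPA e !KP0l; exact: cs_zero.
have [[u [bu le' _ _ e']]|[_ e']] := sm_sp_cases (etrans dl (degaddC _ _)); last first.
  by rewrite -!KPA e' !KP0r; exact: cs_zero.
rewrite KPA e -KPA e'; apply: cs_gen.
have stu : ks t = ks u by rewrite -(ks_comp at_) -le le' ks_comp.
have au : ks a = kr u by rewrite sab.
split=> // g rg; have ug : ks u = kr g by rewrite -stu.
(* Compression by s_a strips [a] from a range projection, so [proj (t · g)] and [proj (u · g)] may
   be compared after prepending [a]. *)
have down h : ks a = kr h -> sm a ** proj (a · h) ** sp a = proj h.
  move=> ah; rewrite /proj -sp_comp // -sm_comp // !KPA sm_spK ah p_sp.
  by rewrite -!KPA sm_spK ah sm_p.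
rewrite -[LHS]/(proj (t · g)) -[RHS]/(proj (u · g)).
rewrite -(down (t · g)) ?kr_comp // -(down (u · g)) ?kr_comp //.
(* The cycline condition for the extension [u · g] replaces [a] by [b]; then a t = b u identifies
   both sides. *)
have -> : proj (a · (u · g)) = proj (b · (u · g)) by apply: ab; rewrite kr_comp.
by rewrite -!kcompA // -le -le'.
Qed.

(** Both alternatives persist under further extension, so the paths of [F] can be treated one after
    another. *)
Lemma common_extension a (F : seq (kP L)) : (forall b, b \in F -> ks a = ks b) ->
  exists g, kr g = ks a /\
    forall b, b \in F -> sm (a · g) ** sp (b · g) = 0 \/ cycline (a · g) (b · g).
Proof.
elim: F => [|b F IH] sF; first by exists (kid (ks a)); rewrite kr_id.
have [|g [rg gP]] := IH; first by move=> c cF; apply: sF; rewrite inE cF orbT.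
have sg c : c \in b :: F -> ks c = kr g by move/sF=> <-.
have ag : ks a = kr g by [].
have bF : b \in b :: F by rewrite inE eqxx.
have [|h [rh hP]] := @cycline_or_disjoint (a · g) (b · g).
  by rewrite !ks_comp // sg.
have gh : ks g = kr h by rewrite rh ks_comp.
exists (g · h); rewrite kr_comp //; split=> // c cbF.
have cg := sg c cbF; rewrite -!kcompA //.
move: cbF; rewrite inE => /orP[/eqP->|cF]; first exact: hP.
have [c0|cc] := gP c cF; [left|right; apply: cycline_ext => //].
  by rewrite sm_sp_ext ?ks_comp // c0 KP0r KP0l.
Qed.

(** * Linear combinations of paths and removal of ghost paths *)

(* Asking for the identity over every support [t] containing [F] makes sums of
   combinations immediate. *)
Definition combination (Q : kP L -> Prop) y := exists (F : seq (kP L)) (c : kP L -> R),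
  (forall a, c a != 0 -> Q a) /\
  forall t, uniq t -> {subset F <= t} -> y = \sum_(a <- t) c a *: sp a.

Lemma combination0 Q : combination Q 0.
Proof.
exists [::], (fun=> 0); split=> [a|t _ _]; first by rewrite eqxx.
by rewrite big1 // => a _; rewrite scale0r.
Qed.

Lemma combination_sp (Q : kP L -> Prop) a : Q a -> combination Q (sp a).
Proof.
move=> Qa; exists [:: a], (fun b => (b == a)%:R); split=> [b|t Ut at_].
  by case: (eqVneq b a) => [->//|_]; rewrite eqxx.
rewrite (bigD1_seq a) ?at_ ?inE //= eqxx scale1r big1 ?addr0 // => b /negbTE->.
by rewrite scale0r.
Qed.

Lemma combinationD Q x y : combination Q x -> combination Q y -> combination Q (x + y).
Proof.
move=> [F [c [cQ cE]]] [G [d [dQ dE]]]; exists (F ++ G), (fun a => c a + d a).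
split=> [a|t Ut FGt].
  by case: (eqVneq (c a) 0) => [->|/cQ//]; rewrite add0r => /dQ.
rewrite (cE t) // ?(dE t) // => [|a aG|a aF].
- by rewrite -big_split; apply: eq_bigr => a _; rewrite scalerDl.
- by apply: FGt; rewrite mem_cat aG orbT.
- by apply: FGt; rewrite mem_cat aF.
Qed.

Lemma combinationZ Q (r : R) x : combination Q x -> combination Q (r *: x).
Proof.
move=> [F [c [cQ cE]]]; exists F, (fun a => r * c a); split=> [a ra|t Ut Ft].
  by apply: cQ; apply: contra_neq ra => ->; rewrite mulr0.
by rewrite (cE t) // scaler_sumr; apply: eq_bigr => a _; rewrite scalerA.
Qed.

Lemma combinationP Q y : combination Q y ->
  exists (F : seq (kP L)) (c : kP L -> R),
    [/\ uniq F, forall a, a \in F -> c a != 0 /\ Q a & y = \sum_(a <- F) c a *: sp a].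
Proof.
move=> [F [c [cQ /(_ (undup F) (undup_uniq _))cE]]].
exists [seq a <- undup F | c a != 0], c; rewrite filter_uniq ?undup_uniq //; split=> // [a|].
  by rewrite mem_filter => /andP[ca _]; split=> //; apply: cQ.
rewrite cE => [|a]; last by rewrite mem_undup.
rewrite big_filter [RHS]big_mkcond; apply: eq_bigr => a _.
by case: eqVneq => //= ->; rewrite scale0r.
Qed.

Lemma combination_mull Q Q' x y : combination Q y ->
  (forall a, Q a -> combination Q' (x ** sp a)) -> combination Q' (x ** y).
Proof.
move=> /combinationP[F [c [_ FQ ->]]] xQ; rewrite KP_sumr big_seq.
elim/big_ind: _ => [|u v|a /FQ[_ /xQ]]; first exact: combination0.
  exact: combinationD.
by rewrite KPZr; apply: combinationZ.
Qed.

Lemma combinationW (Q Q' : kP L -> Prop) y :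
  (forall a, Q a -> Q' a) -> combination Q y -> combination Q' y.
Proof. by move=> QQ' [F [c [cQ cE]]]; exists F, c; split=> // a /cQ/QQ'. Qed.

(* Multiplication by [s_b] for [b] long enough removes every ghost path from [z]. *)
Lemma mul_long_path z : exists N, forall b n, kd b = degadd N n ->
  combination (fun a => ks a = ks b /\ exists j, kd a = degadd n j) (z ** sp b).
Proof.
elim/(KP_ind KPB): z => [|x y [N xN] [N' yN]|r x [N xN]|x y [N xN] [N' yN]|l|l].
- by exists (deg0 k) => b n _; rewrite KP0l; exact: combination0.
- exists (degadd N N') => b n db; rewrite KPDl; apply: combinationD.
    apply: combinationW (xN b (degadd N' n) _) => [a [sa [j dj]]|]; last by rewrite degaddA.
    by split=> //; exists (degadd N' j); rewrite dj (degaddC N') degaddA.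
  apply: combinationW (yN b (degadd N n) _) => [a [sa [j dj]]|].
    by split=> //; exists (degadd N j); rewrite dj (degaddC N) degaddA.
  by rewrite degaddA (degaddC N').
- by exists N => b n /xN H; rewrite KPZl; apply: combinationZ.
(* The lower bound on degrees is used here: after [y] has acted, the remaining paths are still long
   enough for [x]. *)
- exists (degadd N' N) => b n; rewrite -degaddA => /yN H.
  rewrite -KPA; apply: combination_mull H _ => a [sa [j]].
  rewrite -degaddA => /xN; apply: combinationW => c [sc [i di]].
  by split; [rewrite sc|exists (degadd j i); rewrite di degaddA].
- exists (deg0 k) => b n; rewrite deg0add => db.
  have [lb|lb] := eqVneq (ks l) (kr b).
    rewrite sp_comp //; apply: combination_sp; split; first by rewrite ks_comp.
    by exists (kd l); rewrite kd_comp // db degaddC.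
  rewrite -(sp_p l) -(p_sp b) KPA -[_ ** p (kr b)]KPA p_orth; last exact/eqP.
  by rewrite KP0r KP0l; exact: combination0.
- exists (kd l) => b n /sm_sp_cases[[t [lt -> dt -> _]]|[-> _]]; last exact: combination0.
  apply: combination_sp; rewrite ks_comp //; split=> //.
  by exists (deg0 k); rewrite degadd0.
Qed.

(** [B] need not have a unit; finite sums of the p_v act as one on the right of a given [z].
    Allowing every larger list lets two elements share one. *)
Lemma local_unit z : exists s : seq (kV L), forall t, uniq t -> {subset s <= t} ->
  z = \sum_(v <- t) z ** p v.
Proof.
have one x v : x ** p v = x -> exists s : seq (kV L), forall t, uniq t -> {subset s <= t} ->
    x = \sum_(v <- t) x ** p v.
  move=> xv; exists [:: v] => t Ut vt; rewrite (bigD1_seq v) ?vt ?inE //= xv big1 ?addr0 // => w wv.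
  by rewrite -xv -KPA p_orth ?KP0r //; apply/eqP; rewrite eq_sym.
elim/(KP_ind KPB): z => [|x y [s xE] [s' yE]|r x [s xE]|x y _ [s yE]|l|l].
- by exists [::] => t _ _; rewrite big1 // => v _; rewrite KP0l.
- exists (s ++ s') => t Ut st; under eq_bigr do rewrite KPDl.
  rewrite big_split -xE // -?yE // => v vs; apply: st; rewrite mem_cat vs ?orbT //.
- exists s => t Ut st; under eq_bigr do rewrite KPZl.
  by rewrite -scaler_sumr -xE.
- exists s => t Ut st; under eq_bigr do rewrite -KPA.
  by rewrite -KP_sumr -yE.
- exact: one (sp_p l).
- exact: one (sm_p l).
Qed.

Lemma nonzero_combination z : z != 0 -> exists b,
  z ** sp b != 0 /\ combination (fun a => ks a = ks b) (z ** sp b).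
Proof.
move=> z0; have [N NP] := mul_long_path z; have [s sE] := local_unit z.
suff [b [db zb]] : exists b, kd b = N /\ z ** sp b != 0.
  exists b; split=> //; apply: combinationW (NP b (deg0 k) _) => [a []//|].
  by rewrite degadd0.
(* If z s_b = 0 for all [b] of degree [N], then (KP4) at degree [N] gives z p_v = 0 for every [v],
   so z = 0. *)
apply: contrapT => nb; move/eqP: z0; apply.
rewrite (sE (undup s)) ?undup_uniq // => [|v]; last by rewrite mem_undup.
rewrite big1 // => v _; have [t [_ tE ->]] := p_sum v N.
rewrite KP_sumr big_seq big1 // => l; rewrite tE => /andP[_ /eqP dl].
have [e|ne] := eqVneq (z ** sp l) 0; first by rewrite KPA e KP0l.
by case: nb; exists l.
Qed.

(** * Compressing a nonzero element into the cycline subalgebra *)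

Lemma p_cycline v : M (p v).
Proof. by rewrite -(p_idem v) -{1}sp_kid -sm_kid; apply: cs_gen. Qed.

Lemma degree_zero_coefficient v : exists E : B -> R,
  [/\ forall y z, E (y + z) = E y + E z, forall (r : R) y, E (r *: y) = r * E y,
      E (p v) = 1 & forall a b, kd a <> kd b -> E (sm a ** sp b) = 0].
Proof.
(* [E] is a matrix coefficient at [(x, 0)] of the path representation. *)
have [x ix rx] := infpath_exists rfns v.
have [pi [[piD piZ piM] piq pip pim]] := path_representation KPB.
(* The operator of s_{a*} s_b evaluates its argument at points whose [Z^k] coordinate is moved by
   d(a) - d(b), and [f0] vanishes there unless the degrees agree. *)
pose f0 : point L -> R^o := fun u : point L => (u.2 == 0)%:R.
exists (fun y => pi y f0 (x, 0)); split=> [y z|r y||a b ab].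
- by rewrite piD.
- by rewrite piZ.
- rewrite piq /transfer /vertex_map; case: pselect => [h|[]] //=.
  by rewrite /f0 eqxx.
rewrite piM pip pim transfer_comp /transfer /shift_map /cat_map.
case: pselect => //= h; case: pselect => //= h'.
rewrite /f0 /= add0r subr_eq0; case: eqP => // /degz_inj //.
Qed.

Lemma cycline_witness z : z != 0 -> exists a b,
  M (sm a ** z ** sp b) /\ sm a ** z ** sp b != 0.
Proof.
move=> /nonzero_combination[b [zb0 /combinationP[F [c [UF FQ zbE]]]]].
case: F UF FQ zbE => [|a F]; first by move=> _ _ e; rewrite e big_nil eqxx in zb0.
move=> /= /andP[aF UF] FQ zbE.
have [ca sa] : c a != 0 /\ ks a = ks b by apply: FQ; rewrite inE eqxx.
have sF d : d \in F -> ks a = ks d.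
  by move=> dF; rewrite sa; have [|_ ->] := FQ d; rewrite ?inE ?dF ?orbT.
have [g [rg gP]] := common_extension sF.
have bg : ks b = kr g by rewrite -sa.
(* The part of the compressed element that comes from the paths other than [a]; it must not cancel
   the term [c a *: p (ks g)]. *)
pose w := \sum_(d <- F) c d *: (sm (a · g) ** sp (d · g)).
have wE : sm (a · g) ** z ** sp (b · g) = c a *: p (ks g) + w.
  rewrite -KPA -sp_comp // [z ** _]KPA zbE big_cons KPDl KPDr; congr (_ + _).
    by rewrite KPZl KPZr sp_comp // sm_spK ks_comp.
  rewrite KP_suml KP_sumr big_seq [RHS]big_seq; apply: eq_bigr => d dF.
  by rewrite KPZl KPZr sp_comp // -sF.
exists (a · g), (b · g); rewrite wE; split.
  apply: cs_add; first by apply: cs_scale; exact: p_cycline.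
  apply: cycline_subalg_sum => d dF; apply: cs_scale.
  by have [->|] := gP d dF; [exact: cs_zero|exact: cycline_sm_sp].
have [E [ED EZ Ep E0]] := degree_zero_coefficient (ks g).
have E00 : E 0 = 0 by rewrite -(scale0r (0 : B)) EZ mul0r.
suff Ew : E w = 0.
  apply: contra_neq ca => e.
  by rewrite -E00 -e ED EZ Ep Ew mulr1 addr0.
rewrite /w big_seq; elim/big_ind: _ => // [u v eu ev|d dF]; first by rewrite ED eu ev addr0.
(* A path of the same degree as [a] differs from [a], so (KP3) kills its term; a path of another
   degree is annihilated by [E]. *)
rewrite EZ; have [dd|dd] := eqVneq (kd a) (kd d).
  rewrite sm_sp_ext // -?(sF d dF) // sm_sp //.
  by case: eqP => [e|_]; [rewrite e dF in aF|rewrite KP0r KP0l E00 mulr0].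
rewrite E0 ?mulr0 // !kd_comp -?(sF d dF) // !(degaddC _ (kd g)) => /degaddI.
exact/eqP.
Qed.

End KumjianPask.

Theorem theorem5p4 (k : nat) (L : kgraph k) (R : comPzRingType) (B : lmodType R)
  (mulB : B -> B -> B) (p : kV L -> B) (sp sm : kP L -> B)
  (A : zmodType) (mulA : A -> A -> A) (Phi : B -> A) :
  row_finite_no_sources L ->
  is_KP_algebra mulB p sp sm ->
  rng_axioms mulA ->
  rng_hom mulB mulA Phi ->
  (injective Phi <->
   (forall x y, cycline_subalg mulB sp sm x -> cycline_subalg mulB sp sm y ->
      Phi x = Phi y -> x = y)).
Proof.
move=> rfns KPB [_ mDl mDr] [PhiD PhiM]; split=> [inj x y _ _ /inj //|injM x y exy].
have Phi0 : Phi 0 = 0 by apply: (addrI (Phi 0)); rewrite -PhiD !addr0.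
have m0l u : mulA 0 u = 0 by apply: (addrI (mulA 0 u)); rewrite -mDl !addr0.
have m0r u : mulA u 0 = 0 by apply: (addrI (mulA u 0)); rewrite -mDr !addr0.
have ker : Phi (x - y) = 0 by apply: (addIr (Phi y)); rewrite -PhiD subrK add0r.
apply/eqP; rewrite -subr_eq0; apply/negPn/negP.
(* The kernel is an ideal, so it contains the compression of [x - y], a nonzero element of the
   cycline subalgebra. *)
move=> /(cycline_witness rfns KPB)[a [b [Mc /negP[]]]]; apply/eqP.
by apply: injM => //; [exact: cs_zero | rewrite !PhiM ker m0r m0l Phi0].
Qed.
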